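(* Let $A$ and $B$ be finitely generated residually finite groups and let $G=A\star B$ be their free product. Then $G$ has a non-expander box space; that is, there exists a sequence $(N_n)_n$ of finite index normal subgroups of $G$ with trivial intersection such that the sequence of finite quotients $(G/N_n)_n$ is not an expander.
   Context: For a finite graph $X=(V,E)$ and $Y\subset V$, the edge boundary $\partial Y\subset E$ is the set of edges joining an element of $Y$ to an element of $V\setminus Y$. The Cheeger constant is $h(X)=\min\{|\partial Y|/|Y| : \emptyset\ne Y\subset V,\ |Y|\le|V|/2\}$. A sequence of finite graphs $(X_n)_n$ is an expander if there is $c>0$ with $h(X_n)\ge c$ for all $n$. Let $S$ be a finite generating set of $G$. For an action of $G$ on a set $Z$, the Schreier graph $X_S(Z)$ has vertex set $Z$ and an edge joining $z$ to $s.z$ for $z\in Z$, $s\in S$. A sequence $(Q_n)_n$ of finite quotients of $G$ is an expander if the sequence of graphs $(X_S(Q_n))_n$ is an expander; this does not depend on the choice of the finite generating set $S$. The box space associated with a sequence $(N_n)_n$ of finite index normal subgroups with trivial intersection is the coarse disjoint union of the quotients $G/N_n$, each endowed with the quotient length induced by a proper length on $G$, and it is called (non-)expander when the sequence $(G/N_n)_n$ is (not) an expander.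
   Formalization: The formal theorem assumes in addition that A and B are both nontrivial; if B is trivial then G = A, and the claim fails for instance when A is finite, since a finite group has only finitely many quotients, all with connected Schreier graphs. *)

(* Defs.v *)
From HB Require Import structures.
From mathcomp Require Import all_boot all_order all_algebra.
From mathcomp Require Import finmap.
From mathcomp Require Import boolp classical_sets functions cardinality.
From mathcomp Require Import reals ereal.

Set Implicit Arguments.
Unset Strict Implicit.
Unset Printing Implicit Defensive.

Import Order.TTheory GRing.Theory Num.Theory.

Local Open Scope group_scope.

(* An edge is the set of its endpoints, so a loop is a singleton and there are
   no multiple edges. *)
Record ugraph := UGraph {
  vertex :> finType;
  edges : {set {set vertex}};
  edges_card : forall e, e \in edges -> (0 < #|e| <= 2)%N
}.

Definition edge_boundary (X : ugraph) (Y : {set X}) : {set {set X}} :=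
  [set e in edges X | [exists y in Y, [exists z in ~: Y, e == [set y; z]]]].

(* The minimum over the empty family, i.e. for at most one vertex, is +oo. *)
Definition cheeger (R : realType) (X : ugraph) : \bar R :=
  \big[Order.min/+oo%E]_(Y : {set X} | (Y != finset.set0) && (#|Y|.*2 <= #|X|)%N)
    (#|edge_boundary Y|%:R / #|Y|%:R)%R%:E.

Definition expander (R : realType) (X : nat -> ugraph) : Prop :=
  exists2 c : R, (0 < c)%R & forall n, (c%:E <= cheeger R (X n))%E.

Definition is_subgroup (G : groupType) (H : set G) : Prop :=
  [/\ H 1, forall x y, H x -> H y -> H (x * y) & forall x, H x -> H x^-1].

Definition generates (G : groupType) (S : seq G) : Prop :=
  forall H : set G, is_subgroup H -> (forall s, s \in S -> H s) ->
  forall g, H g.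

Definition finitely_generated (G : groupType) : Prop :=
  exists S : seq G, generates S.

Definition left_coset (G : groupType) (H : set G) (g : G) : set G :=
  [set g * x | x in H]%classic.

Definition left_cosets (G : groupType) (H : set G) : set (set G) :=
  range (left_coset H).

Record fin_index_normal (G : groupType) := FinIndexNormal {
  fin_carrier :> G -> Prop;
  fin_subgroup : is_subgroup fin_carrier;
  fin_normal : forall g x, fin_carrier x -> fin_carrier (x ^ g);
  fin_index : finite_set (left_cosets fin_carrier)
}.

Definition residually_finite (G : groupType) : Prop :=
  forall g : G, g != 1 -> exists N : fin_index_normal G, ~ N g.

(* Both free factors are assumed nontrivial: if B = 1 then G = A, and every box
   space of A is an expander as soon as A is finite or has property (tau),
   e.g. A = SL_3(Z). *)
Definition nontrivial (G : groupType) : Prop := exists g : G, g != 1.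

Record group_action (G : groupType) (Z : Type) := GroupAction {
  act :> G -> Z -> Z;
  act1 : forall z, act 1 z = z;
  actM : forall g h z, act (g * h) z = act g (act h z)
}.

Section Schreier.
Variables (G : groupType) (S : seq G) (Z : finType) (a : group_action G Z).

Definition schreier_edges : {set {set Z}} :=
  [set e : {set Z} | [exists z, has (fun s => e == [set z; a s z]) S]].

Lemma schreier_edges_card e : e \in schreier_edges -> (0 < #|e| <= 2)%N.
Proof.
rewrite inE => /existsP[z /hasP[s _ /eqP->]].
by rewrite cards2; case: (_ != _).
Qed.

Definition schreier_graph : ugraph := UGraph schreier_edges_card.

End Schreier.

(* The finite type underlying G / N, its elements being the cosets g N. *)
Definition quotient_type (G : groupType) (N : fin_index_normal G) : finType :=
  fset_set (left_cosets N).

Section Translation.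
Variables (G : groupType) (N : fin_index_normal G).

Lemma translate_subproof (g : G) (C : quotient_type N) :
  [set g * x | x in val C]%classic \in fset_set (left_cosets N).
Proof.
have := valP C; rewrite !in_fset_set ?inE; try exact: fin_index.
move=> [h _ <-]; exists (g * h) => //=.
rewrite /left_coset image_comp.
by apply: eq_imagel => x _ /=; rewrite mulgA.
Qed.

Definition translate (g : G) (C : quotient_type N) : quotient_type N :=
  [` translate_subproof g C]%fset.

Lemma translate1 C : translate 1 C = C.
Proof.
apply: val_inj => /=; rewrite -[RHS]image_id.
by apply: eq_imagel => x _; rewrite mul1g.
Qed.

Lemma translateM g h C : translate (g * h) C = translate g (translate h C).
Proof.
apply: val_inj => /=; rewrite image_comp.
by apply: eq_imagel => x _ /=; rewrite mulgA.
Qed.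

(* g . (x N) = (g x) N *)
Definition translation : group_action G (quotient_type N) :=
  GroupAction translate1 translateM.

End Translation.

(* Whether the Schreier graphs form an expander does not depend on the finite
   generating set S; as S is quantified existentially here, the negation of
   this predicate denies the expander property for every S. *)
Definition expander_quotients (R : realType) (G : groupType)
    (N : nat -> fin_index_normal G) : Prop :=
  exists2 S : seq G, generates S
    & expander R (fun n => schreier_graph S (translation (N n))).

(* (G, iA, iB) is a coproduct of A and B in the category of groups. *)
Definition is_free_product (A B G : groupType)
    (iA : {multiplicative A -> G}) (iB : {multiplicative B -> G}) : Prop :=
  forall (H : groupType) (f : {multiplicative A -> H})
         (g : {multiplicative B -> H}),
  exists h : {multiplicative G -> H},
    [/\ h \o iA =1 f, h \o iB =1 g
      & forall k : {multiplicative G -> H},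
          k \o iA =1 f -> k \o iB =1 g -> k =1 h].

(* Main.v *)
(* By the universal property, actions of A and B on one finite set Z extend to
   an action of G, and the kernel of that action has finite index.

   Residual finiteness of G: write g <> 1 as a shortest product of letters from
   A and B, and let the letters trace a path of distinct points. Finite quotients
   of A in which its letters survive realize the A-steps of the path, similarly
   for B, and a permutation of a common finite set makes the two paths agree.

   Slow expansion: let X and Y be nontrivial finite quotients of A and B, and let
   A act on the first coordinate of X * Y * Z/2(m+1), and B on the second one,
   conjugated by the permutation that shifts the last coordinate over the base
   point (x0, y0). This action is transitive, but an element g of G moves at most
   C(g) points in or out of the lower half of the levels, uniformly in m. Pulling
   that half back to the quotient of G by the kernel gives a Cheeger constant
   O(1/m). Interleaving these kernels with a sequence that separates the points
   of the countable group G proves the theorem. *)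
From HB Require Import structures.
From mathcomp Require Import all_boot all_order all_algebra all_fingroup.
From mathcomp Require Import finmap.
From mathcomp Require Import boolp classical_sets functions cardinality.
From mathcomp Require Import reals ereal.
Require Import Defs.

Set Implicit Arguments.
Unset Strict Implicit.
Unset Printing Implicit Defensive.

Import Order.TTheory GRing.Theory Num.Theory.

Local Open Scope group_scope.

(** * Subgroups as groups, and generation of a free product by its factors *)

Section MultiplicativeTheory.
Variables (G H : groupType) (f : {multiplicative G -> H}).

Lemma multiplicative1 : f 1 = 1.
Proof. by apply: (@mulgI _ (f 1)); rewrite -gmulfM !mulg1. Qed.

Lemma multiplicativeV x : f x^-1 = (f x)^-1.
Proof. by apply/esym/mulg1_eq; rewrite -gmulfM mulgV multiplicative1. Qed.

End MultiplicativeTheory.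

(** A subgroup has to be a [groupType] to serve as target in the universal property. *)
Definition subgroup_type (G : groupType) (H : set G) of is_subgroup H :=
  {x : G | `[< H x >]}.

Section SubgroupType.
Variables (G : groupType) (H : set G) (subH : is_subgroup H).

HB.instance Definition _ := SubChoice.on (subgroup_type subH).

Lemma subgroup_group_closed : group_closed (fun x : G => `[< H x >]).
Proof.
case: subH => H1 HM HV; split; first exact/asboolP.
by move=> x y /asboolP Hx /asboolP Hy; apply/asboolP/HM/HV.
Qed.

HB.instance Definition _ :=
  SubChoice_isSubGroup.Build G _ (subgroup_type subH) subgroup_group_closed.

Definition subgroup_val : {multiplicative subgroup_type subH -> G} := val.

Section Corestriction.
Variables (A : groupType) (f : {multiplicative A -> G}).
Hypothesis Hf : forall a, H (f a).

Definition corestrict (a : A) : subgroup_type subH := exist _ (f a) (asboolT (Hf a)).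

Lemma corestrictM : {morph corestrict : x y / x * y}.
Proof. by move=> x y; apply: val_inj; rewrite /= gmulfM. Qed.

HB.instance Definition _ := isMultiplicative.Build _ _ corestrict corestrictM.

Definition corestriction : {multiplicative A -> subgroup_type subH} := corestrict.

End Corestriction.
End SubgroupType.

Section FreeProduct.
Variables (A B G : groupType).
Variables (iA : {multiplicative A -> G}) (iB : {multiplicative B -> G}).
Hypothesis freeG : is_free_product iA iB.

(** The morphism into [H] given by the universal property, followed by the inclusion, agrees with
    the identity on both factors; by uniqueness it is the identity of [G]. *)
Lemma free_product_generated (H : set G) : is_subgroup H ->
  (forall a, H (iA a)) -> (forall b, H (iB b)) -> forall g, H g.
Proof.
move=> subH HA HB g.
have [h [hA hB _]] :=
  freeG (corestriction subH HA) (corestriction subH HB).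
have [k [_ _ uniq]] := freeG iA iB.
have idE : idfun =1 k by apply: (uniq idfun).
have hE : subgroup_val subH \o h =1 k.
  apply: uniq => x /=; first by rewrite [h _]hA.
  by rewrite [h _]hB.
by have := idE g; rewrite -hE /= => ->; apply/asboolP; apply: (valP (h g)).
Qed.

End FreeProduct.

(** * Finite permutation actions of a free product and their kernels *)

Section PermMorphism.
Variables (G : groupType) (Z : finType) (a : group_action G Z).

Lemma actK g : cancel (a g) (a g^-1).
Proof. by move=> z; rewrite -actM mulVg act1. Qed.

Lemma actVK g : cancel (a g^-1) (a g).
Proof. by move=> z; rewrite -actM mulgV act1. Qed.

(* Permutations compose from left to right, whereas actions are on the left,
   hence the inverse. *)
Definition act_perm (g : G) : {perm Z} := perm (can_inj (actK g^-1)).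

Lemma act_permM : {morph act_perm : x y / x * y}.
Proof. by move=> x y; apply/permP => z; rewrite permM !permE invgM actM. Qed.

HB.instance Definition _ := isMultiplicative.Build G {perm Z} act_perm act_permM.

Definition act_morphism : {multiplicative G -> {perm Z}} := act_perm.

End PermMorphism.

Section MorphismAction.
Variables (G : groupType) (Z : finType) (h : {multiplicative G -> {perm Z}}).

Definition perm_act (g : G) (z : Z) : Z := (h g)^-1 z.

Lemma perm_act1 z : perm_act 1 z = z.
Proof. by rewrite /perm_act multiplicative1 invg1 perm1. Qed.

Lemma perm_actM x y z : perm_act (x * y) z = perm_act x (perm_act y z).
Proof. by rewrite /perm_act gmulfM invgM permM. Qed.

Definition perm_action : group_action G Z := GroupAction perm_act1 perm_actM.
End MorphismAction.

Section JointAction.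
Variables (A B G : groupType).
Variables (iA : {multiplicative A -> G}) (iB : {multiplicative B -> G}).
Hypothesis freeG : is_free_product iA iB.

Lemma joint_action (Z : finType) (aA : group_action A Z) (aB : group_action B Z) :
  exists a : group_action G Z,
    (forall x z, a (iA x) z = aA x z) /\ (forall y z, a (iB y) z = aB y z).
Proof.
have [h [hA hB _]] := freeG (act_morphism aA) (act_morphism aB).
exists (perm_action h); split=> x z /=; rewrite /perm_act.
- by rewrite [h _]hA /= -multiplicativeV permE invgK.
- by rewrite [h _]hB /= -multiplicativeV permE invgK.
Qed.
End JointAction.
Section ActKernel.
Variables (G : groupType) (Z : finType) (a : group_action G Z).

Definition act_ker : set G := fun g => forall z, a g z = z.

Lemma act_ker_subgroup : is_subgroup act_ker.
Proof.
split=> [|x y kx ky|x kx] z; first exact: act1.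
- by rewrite actM ky kx.
- by rewrite -[in LHS](kx z) -actM mulVg act1.
Qed.

Lemma act_ker_normal g x : act_ker x -> act_ker (x ^ g).
Proof. by move=> kx z; rewrite conjgE !actM kx -actM mulVg act1. Qed.

(** A coset of the kernel is determined by the function through which its elements act; as [Z] has
    finitely many self-maps, this yields finite index. *)
Lemma act_ker_coset g :
  left_coset act_ker g = [set x | [ffun z => a x z] = [ffun z => a g z]]%classic.
Proof.
apply/seteqP; split=> [_ [x kx <-]|x] /=.
  by apply/ffunP => z; rewrite !ffunE actM kx.
move=> /ffunP E; exists (g^-1 * x); last by rewrite mulKVg.
by move=> z; have := E z; rewrite !ffunE actM => ->; rewrite -actM mulVg act1.
Qed.

Lemma act_ker_index : finite_set (left_cosets act_ker).
Proof.
pose h (F : {ffun Z -> Z}) := [set x | [ffun z => a x z] = F]%classic.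
apply: (sub_finite_set (B := (h @` [set: {ffun Z -> Z}])%classic)).
  by move=> _ [g _ <-]; exists [ffun z => a g z] => //; rewrite act_ker_coset.
exact/finite_image/finite_finset.
Qed.

Definition kernel : fin_index_normal G :=
  FinIndexNormal act_ker_subgroup act_ker_normal act_ker_index.

End ActKernel.

(** * The translation action on a finite quotient *)

Section Quotient.
Variables (G : groupType) (N : fin_index_normal G).

Lemma quotient_subproof g : left_coset N g \in fset_set (left_cosets N).
Proof. by rewrite in_fset_set ?inE; [exists g | exact: fin_index]. Qed.

Definition quotient_class (g : G) : quotient_type N := [` quotient_subproof g]%fset.

Lemma quotient_class_surj C : exists g, C = quotient_class g.
Proof.
have := valP C; rewrite in_fset_set ?inE; last exact: fin_index.
by case=> g _ E; exists g; apply: val_inj.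
Qed.

Lemma translation_class g h : translation N g (quotient_class h) = quotient_class (g * h).
Proof.
apply: val_inj => /=; rewrite /left_coset image_comp.
by apply: eq_imagel => x _ /=; rewrite mulgA.
Qed.

Lemma quotient_class_eq g h : quotient_class g = quotient_class h -> N (g^-1 * h).
Proof.
move=> /(congr1 val) /= E; have [N1 _ _] := fin_subgroup N.
have : left_coset N h h by exists 1 => //=; rewrite mulg1.
by rewrite -E => -[x Nx <-]; rewrite mulKg.
Qed.

(** The stabilizer of the coset [h N] is the conjugate of [N] by [h], which is [N] by normality. *)
Lemma translation_fixes g C : translation N g C = C -> N g.
Proof.
have [h ->] := quotient_class_surj C.
rewrite translation_class => /esym/quotient_class_eq /(@fin_normal _ N h^-1).
by rewrite conjgE invgK !mulgA mulgV mul1g -mulgA mulgV mulg1.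
Qed.

Lemma translation_transitive C D : exists g, translation N g C = D.
Proof.
have [h ->] := quotient_class_surj C; have [k ->] := quotient_class_surj D.
by exists (k * h^-1); rewrite translation_class mulgVK.
Qed.

End Quotient.

(** * Finite actions that realize prescribed paths *)

Section ProductAction.
Variables (G : groupType) (X Y : Type) (a : group_action G X).

Definition prod_act (b : group_action G Y) (g : G) (z : X * Y) : X * Y :=
  (a g z.1, b g z.2).

Lemma prod_act1 b z : prod_act b 1 z = z.
Proof. by case: z => x y; rewrite /prod_act !act1. Qed.

Lemma prod_actM b g h z : prod_act b (g * h) z = prod_act b g (prod_act b h z).
Proof. by rewrite /prod_act !actM. Qed.

Definition prod_action b : group_action G (X * Y) :=
  GroupAction (prod_act1 b) (prod_actM b).

Definition trivial_action : group_action G Y :=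
  @GroupAction G Y (fun _ y => y) (fun=> erefl) (fun _ _ _ => erefl).

End ProductAction.

(** Take the product of one finite quotient per letter, each chosen so that its letter survives;
    that letter then moves the corresponding coordinate. *)
Lemma residually_finite_moves (A : groupType) : residually_finite A ->
  forall s : seq A, 1 \notin s ->
  exists (X : finType) (a : group_action A X) (x0 : X),
    forall g, g \in s -> a g x0 != x0.
Proof.
move=> rfA; elim=> [_|g s IHs]; first by exists unit, (trivial_action A unit), tt.
rewrite inE negb_or => /andP[g1 /IHs[X [a [x0 Hx0]]]].
have [|N Ng] := rfA g; first by rewrite eq_sym.
exists (X * quotient_type N)%type, (prod_action a (translation N)).
exists (x0, quotient_class N 1) => k; rewrite inE /= xpair_eqE negb_and.
case/predU1P=> [->|/Hx0->//].
by apply/orP; right; apply/eqP => /translation_fixes.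
Qed.

Lemma perm_of_uniq (Z : finType) (s t : seq Z) : uniq s -> uniq t ->
  size s = size t -> exists p : {perm Z}, map p s = t.
Proof.
elim: s t => [|x s IHs] [|y t] //=; first by exists 1.
move=> /andP[xs us] /andP[yt ut] [/(IHs t us ut)[p Ep]].
(* The transposition is applied after [p]. It fixes the images of the points of [s], which differ
   from [p x] and from [y]. *)
exists (p * tperm (p x) y); congr (_ :: _); first by rewrite permM tpermL.
rewrite -[RHS]map_id -Ep -map_comp; apply/eq_in_map => z zs /=.
rewrite permM tpermD //.
  by apply: contraNneq xs => /perm_inj->.
by apply: contraNneq yt => ->; rewrite -Ep map_f.
Qed.

Lemma perm_of_inj (I Z : finType) (f g : I -> Z) : injective f -> injective g ->
  exists p : {perm Z}, forall i, p (f i) = g i.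
Proof.
move=> injf injg.
have [|||p /esym E] := @perm_of_uniq Z (codom f) (codom g).
- exact/injectiveP.
- exact/injectiveP.
- by rewrite !size_codom.
exists p => i; move: E; rewrite /codom /image_mem -map_comp.
by move=> /eq_in_map/(_ i (mem_enum _ _)).
Qed.

Section ConjugateAction.
Variables (G : groupType) (Z : finType) (a : group_action G Z) (p : {perm Z}).

Definition conj_act (g : G) (z : Z) : Z := p (a g (p^-1 z)).

Lemma conj_act1 z : conj_act 1 z = z.
Proof. by rewrite /conj_act act1 permKV. Qed.

Lemma conj_actM g h z : conj_act (g * h) z = conj_act g (conj_act h z).
Proof. by rewrite /conj_act permK actM. Qed.

Definition conj_action : group_action G Z := GroupAction conj_act1 conj_actM.

End ConjugateAction.
(* Every letter gets its own copy of the finite action, so that the only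
   coincidence to exclude is [l i] fixing the base point. *)
Lemma residually_finite_path (A : groupType) : residually_finite A ->
  forall (k : nat) (l : nat -> option A), (forall i, l i != Some 1) ->
    (forall i, l i -> l i.+1 = None) ->
  exists (X : finType) (a : group_action A X) (e : nat -> X),
    {in gtn k &, injective e} /\
    forall i g, i.+1 < k -> l i = Some g -> a g (e i.+1) = e i.
Proof.
move=> rfA k l l1 ll.
have [|X [a [x0 Hx0]]] := @residually_finite_moves A rfA (pmap l (iota 0 k)).
  by rewrite mem_pmap; apply/mapP => -[i _ /esym/eqP]; rewrite (negPf (l1 i)).
exists ('I_k.+1 * X)%type, (prod_action (trivial_action A 'I_k.+1) a).
(* If [l i = Some g], then [l i.+1 = None], so [e i.+1] is the base point of copy [i.+1] and [e i]
   is its image under [g]. Copy [k] can occur, hence ['I_k.+1]. *)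
exists (fun j => if l j is Some g then (inord j.+1, a g x0) else (inord j, x0)).
have move_x0 i g : i < k -> l i = Some g -> a g x0 <> x0.
  move=> ik E; apply/eqP/Hx0; rewrite mem_pmap; apply/mapP.
  by exists i; rewrite ?mem_iota.
have val_inord i : i <= k -> (inord i : 'I_k.+1) = i :> nat by move=> ik; rewrite inordK.
split=> [i j ik jk|i g ik li]; last first.
  by rewrite li ll ?li.
wlog ij : i j ik jk / i <= j.
  by move=> W E; case: (leqP i j) => [/W->//|/ltnW/W W']; apply/esym/W'.
rewrite !inE in ik jk.
case li: (l i) => [g|]; case lj: (l j) => [h|] [] /(congr1 val) /=;
  rewrite !val_inord ?(ltnW ik) ?(ltnW jk) //.
- by case.
- by move=> _ E; case: (move_x0 i g).
- by move=> E; move: ij; rewrite E ltnn.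
Qed.

(** * Shortest words and residual finiteness of the free product *)

Section FreeProductWords.
Variables (A B G : groupType).
Variables (iA : {multiplicative A -> G}) (iB : {multiplicative B -> G}).

Definition letter_val (s : A + B) : G :=
  match s with inl x => iA x | inr y => iB y end.

Definition word_val (w : seq (A + B)) : G := foldr (fun s g => letter_val s * g) 1 w.

Lemma word_val_cat u v : word_val (u ++ v) = word_val u * word_val v.
Proof. by elim: u => [|s u IHu] /=; rewrite ?mul1g // IHu mulgA. Qed.

Definition letter_inv (s : A + B) : A + B :=
  match s with inl x => inl x^-1 | inr y => inr y^-1 end.

Lemma word_val_inv w : word_val (rev (map letter_inv w)) = (word_val w)^-1.
Proof.
elim: w => [|s w IHw] /=; first by rewrite invg1.
rewrite rev_cons -cats1 word_val_cat IHw invgM /= mulg1.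
by case: s => s /=; rewrite multiplicativeV.
Qed.

(** Minimal length stands in for normal forms: applied to all suffixes, it forces nontrivial letters
    that alternate between the factors. *)
Definition shortest (w : seq (A + B)) : Prop :=
  forall v, word_val v = word_val w -> size w <= size v.

Lemma shortest_cons s w : shortest (s :: w) -> shortest w.
Proof. by move=> sw v E; have := sw (s :: v); rewrite /= E ltnS; apply. Qed.

Lemma shortest_drop i w : shortest w -> shortest (drop i w).
Proof.
elim: w i => [|s w IHw] [|i] //= /shortest_cons; exact: IHw.
Qed.

Lemma shortest_inl1 w : ~ shortest (inl 1 :: w).
Proof.
by move=> /(_ w); rewrite /= multiplicative1 mul1g ltnn => /(_ erefl).
Qed.

Lemma shortest_inr1 w : ~ shortest (inr 1 :: w).
Proof.
by move=> /(_ w); rewrite /= multiplicative1 mul1g ltnn => /(_ erefl).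
Qed.

Lemma shortest_inlM x y w : ~ shortest [:: inl x, inl y & w].
Proof.
by move=> /(_ (inl (x * y) :: w)); rewrite /= gmulfM mulgA ltnn => /(_ erefl).
Qed.

Lemma shortest_inrM x y w : ~ shortest [:: inr x, inr y & w].
Proof.
by move=> /(_ (inr (x * y) :: w)); rewrite /= gmulfM mulgA ltnn => /(_ erefl).
Qed.

Definition head_inl (w : seq (A + B)) : option A :=
  if w is inl x :: _ then Some x else None.

Definition head_inr (w : seq (A + B)) : option B :=
  if w is inr y :: _ then Some y else None.

Lemma drop_head (T : Type) i (s : T) w v : drop i w = s :: v -> drop i.+1 w = v.
Proof. by move=> E; rewrite -add1n -drop_drop E /= drop0. Qed.

Hypothesis freeG : is_free_product iA iB.

Lemma word_val_surj g : exists w, word_val w = g.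
Proof.
suff : range word_val g by case=> w; exists w.
move: g; apply: (free_product_generated freeG).
- split; first by exists [::].
  + by move=> _ _ [u _ <-] [v _ <-]; exists (u ++ v); rewrite // word_val_cat.
  + by move=> _ [w _ <-]; exists (rev (map letter_inv w)); rewrite // word_val_inv.
- by move=> x; exists [:: inl x]; rewrite //= mulg1.
- by move=> y; exists [:: inr y]; rewrite //= mulg1.
Qed.

Lemma shortest_exists g : exists2 w, word_val w = g & shortest w.
Proof.
have : exists n, `[< exists2 w, word_val w = g & size w = n >].
  by have [w Ew] := word_val_surj g; exists (size w); apply/asboolP; exists w.
move=> /ex_minnP[n /asboolP[w Ew <-] minw]; exists w => // v Ev.
by apply: minw; apply/asboolP; exists v; rewrite ?Ev.
Qed.

Hypotheses (rfA : residually_finite A) (rfB : residually_finite B).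

Lemma free_product_residually_finite : residually_finite G.
Proof.
move=> g g1; have [w Ew sw] := shortest_exists g.
have sd i := @shortest_drop i w sw.
pose k := (size w).+1.
have [||X [aX [eX [injX stepX]]]] :=
    @residually_finite_path A rfA k (fun i => head_inl (drop i w)).
- move=> i; apply/eqP => E; have := sd i; move: E.
  by case: drop => [|[x|y] v] //= [->] /shortest_inl1.
- move=> i; case E: (drop i w) (sd i) => [|[x|y] v] //= + _.
  by rewrite (drop_head E); case: v {E} => [|[z|z] v] // /shortest_inlM.
have [||Y [aY [eY [injY stepY]]]] :=
    @residually_finite_path B rfB k (fun i => head_inr (drop i w)).
- move=> i; apply/eqP => E; have := sd i; move: E.
  by case: drop => [|[x|y] v] //= [->] /shortest_inr1.
- move=> i; case E: (drop i w) (sd i) => [|[x|y] v] //= + _.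
  by rewrite (drop_head E); case: v {E} => [|[z|z] v] // /shortest_inrM.
(* The [A]-path runs inside [X * {eY 0}] and the [B]-path inside [{eX 0} * Y]. Conjugation by [p]
   carries the second onto the first, so both factors move along [fX]. *)
pose fX (i : 'I_k) := (eX i, eY 0); pose fY (i : 'I_k) := (eX 0, eY i).
have [||p Hp] := @perm_of_inj 'I_k (X * Y)%type fY fX.
- by move=> i j [] /injY E; apply: val_inj; apply: E; rewrite inE.
- by move=> i j [] /injX E; apply: val_inj; apply: E; rewrite inE.
pose bX := prod_action aX (trivial_action A Y).
pose bY := conj_action (prod_action (trivial_action B X) aY) p.
have [a [aA aB]] := joint_action freeG bX bY.
exists (kernel a) => /(_ (eX (size w), eY 0)); rewrite -Ew => fixw.
(* The last letter of a product acts first, so the path is traversed from its end, by induction on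
   the suffixes of [w]. *)
have stepw v i : drop i w = v ->
    a (word_val v) (eX (size w), eY 0) = (eX (size w - size v), eY 0).
  elim: v i => [|s v IHv] i E; first by rewrite act1 subn0.
  have sz : size w - size (s :: v) = i.
    rewrite -E size_drop subKn // ltnW //.
    by rewrite ltnNge; apply: contra_eqN E => /drop_oversize->.
  have iw : i.+1 < k.
    rewrite ltnS ltnNge; apply: contra_eqN E => /drop_oversize->//.
  have Ev := drop_head E.
  rewrite /= actM (IHv i.+1 Ev) sz -Ev size_drop subKn //.
  case: s E {sz} => s E /=.
    by rewrite aA /= /prod_act /= (stepX i) ?E.
  have hX := Hp (Ordinal iw); have hX' := Hp (Ordinal (ltnW iw)).
  rewrite /fX /fY /= in hX hX'.
  by rewrite aB /= /conj_act -hX permK /= /prod_act /= (stepY i) ?E.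
(* If [g] fixed the end of the path, both ends would coincide, so [w] would be empty and [g]
   trivial. *)
have := stepw w 0 (drop0 w); rewrite fixw subnn => -[/injX].
rewrite !inE => /(_ (leqnn _) isT) /size0nil w0.
by move: g1; rewrite -Ew w0 eqxx.
Qed.
End FreeProductWords.

(** * Finite generation, countability and separating sequences *)

Lemma free_product_finitely_generated (A B G : groupType)
    (iA : {multiplicative A -> G}) (iB : {multiplicative B -> G}) :
  is_free_product iA iB ->
  finitely_generated A -> finitely_generated B -> finitely_generated G.
Proof.
move=> freeG [SA genA] [SB genB]; exists (map iA SA ++ map iB SB) => H subH SH.
have [H1 HM HV] := subH.
apply: (free_product_generated freeG subH).
- apply: (genA (fun x => H (iA x))) => [|s sS]; last first.
    by apply: SH; rewrite mem_cat map_f.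
  split=> [|x y Hx Hy|x Hx]; first by rewrite multiplicative1.
    by rewrite gmulfM; apply: HM.
  by rewrite multiplicativeV; apply: HV.
- apply: (genB (fun x => H (iB x))) => [|s sS]; last first.
    by apply: SH; rewrite mem_cat orbC map_f.
  split=> [|x y Hx Hy|x Hx]; first by rewrite multiplicative1.
    by rewrite gmulfM; apply: HM.
  by rewrite multiplicativeV; apply: HV.
Qed.

Lemma finitely_generated_countable (G : groupType) : finitely_generated G ->
  exists f : nat -> G, forall g, exists n, f n = g.
Proof.
move=> [S genS].
(* Letters are coded by a sign, [true] meaning inverse, and an index into [S], so that words form a
   countable type; an index out of range gives 1. *)
pose letter (s : bool * nat) : G := if s.1 then (nth 1 S s.2)^-1 else nth 1 S s.2.
pose word (w : seq (bool * nat)) : G := \prod_(s <- w) letter s.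
exists (fun n => word (odflt [::] (choice.unpickle n))) => g.
suff [w _ <-] : range word g by exists (choice.pickle w); rewrite choice.pickleK.
move: g; apply: genS => [|s sS]; last first.
  by exists [:: (false, index s S)]; rewrite // /word big_seq1 /letter /= nth_index.
split; first by exists [::]; rewrite // /word big_nil.
  by move=> _ _ [u _ <-] [v _ <-]; exists (u ++ v); rewrite // /word big_cat.
move=> _ [w _ <-]; exists (rev [seq (~~ s.1, s.2) | s <- w]) => //.
rewrite /word; elim: w => [|[b i] w IHw] /=; first by rewrite !big_nil invg1.
rewrite rev_cons -cats1 big_cat IHw big_seq1 big_cons invgM /=.
by case: b; rewrite /letter /= ?invgK.
Qed.

Lemma separating_sequence (G : groupType) : finitely_generated G ->
  residually_finite G ->
  exists N : nat -> fin_index_normal G, forall g, (forall n, N n g) -> g = 1.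
Proof.
move=> /finitely_generated_countable[f surjf] rfG.
have [N HN] : {N : nat -> fin_index_normal G & forall n, N n (f n) -> f n = 1}.
  apply: (@choice _ _ (fun n (N : fin_index_normal G) => N (f n) -> f n = 1)) => n.
  have [->|/rfG[N nN]] := eqVneq (f n) 1; last by exists N.
  by exists (kernel (trivial_action G unit)).
by exists N => g Ng; have [n gE] := surjf g; rewrite -gE; apply: HN; rewrite gE.
Qed.

(** * Boundary counts in Schreier graphs and a bound on the Cheeger constant *)

Definition flip (Z : finType) (P : {set Z}) (f : Z -> Z) : {set Z} :=
  [set z | (z \in P) (+) (f z \in P)].

Section Flip.
Variables (Z : finType) (P : {set Z}).

(** A point that changes sides under [f \o g] either does so under [g], or has an image under [g]
    that does so under [f]; injectivity bounds the number of the latter. *)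
Lemma card_flip_comp (f g : Z -> Z) : injective g ->
  #|flip P (f \o g)| <= #|flip P f| + #|flip P g|.
Proof.
move=> injg; rewrite addnC -(card_preimset (flip P f) injg).
apply: leq_trans (leq_card_setU _ _); apply: subset_leq_card.
apply/fintype.subsetP => z.
by rewrite !inE /=; case: (z \in P); case: (g z \in P); case: (f _ \in P).
Qed.

Lemma card_flip_can (f g : Z -> Z) : cancel f g -> cancel g f ->
  #|flip P g| = #|flip P f|.
Proof.
move=> fK gK; rewrite -(card_preimset (flip P f) (can_inj gK)).
by apply: eq_card => z; rewrite !inE gK addbC.
Qed.

End Flip.

Section SchreierBoundary.
Variables (G : groupType) (S : seq G) (X : finType) (a : group_action G X).

(** A boundary edge joins some [z] to [a s z] with exactly one end in [W], so [s] flips [z].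
    Distinct pairs may give the same edge, hence only an inequality. *)
Lemma card_edge_boundary_schreier (W : {set X}) :
  #|edge_boundary (X := schreier_graph S a) W| <= \sum_(s <- S) #|flip W (a s)|.
Proof.
pose ends s := [seq [set z; a s z] | z <- enum (flip W (a s))].
apply: (@leq_trans (size (flatten (map ends S)))).
  apply: leq_trans (card_size _); apply: subset_leq_card; apply/fintype.subsetP => e.
  rewrite inE => /andP[]; rewrite inE => /existsP[z /hasP[s sS /eqP Ee]].
  move=> /existsP[x /andP[xW /existsP[y /andP[]]]]; rewrite inE => yW /eqP Ee'.
  apply/flattenP; exists (ends s); first exact: map_f.
  apply/mapP; exists z; rewrite // mem_enum inE.
  have E (u : X) : (u \in [set z; a s z]) = (u \in [set x; y]) by rewrite -Ee -Ee'.
  (* Of the four ways to match [x] and [y] with the ends [z] and [a s z], two would put [y] in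
     [W]. *)
  move: (E x) (E y); rewrite !inE !eqxx orbT => /orP[]/eqP xE /orP[]/eqP yE.
  - by case/negP: yW; rewrite yE -xE.
  - by apply: (introT addbP); rewrite -yE -xE xW (negPf yW).
  - by apply: (introT addbP); rewrite -xE -yE xW (negPf yW).
  - by case/negP: yW; rewrite yE -xE.
rewrite size_flatten sumnE !big_map; apply: eq_leq; apply: eq_bigr => s _.
by rewrite size_map cardE.
Qed.

End SchreierBoundary.

Definition transitive_action (G : groupType) (Z : Type) (a : group_action G Z) : Prop :=
  forall z w, exists g, a g z = w.

(** By transitivity, group elements carry any fibre of [f] onto any other, so [k] is the common size
    of the fibres. *)
Lemma equivariant_card_preimset (G : groupType) (X Z : finType)
    (aX : group_action G X) (aZ : group_action G Z) (f : X -> Z) :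
  (forall g x, f (aX g x) = aZ g (f x)) -> transitive_action aZ ->
  exists k, forall P : {set Z}, #|f @^-1: P| = (#|P| * k)%N.
Proof.
move=> fE trZ; case: (pickP (mem Z)) => [z0 _|Z0]; last first.
  exists 0 => P; rewrite muln0; apply: eq_card0 => x.
  by have := Z0 (f x); rewrite inE.
exists #|f @^-1: [set z0]| => P.
have fibre z : #|f @^-1: [set z]| = #|f @^-1: [set z0]|.
  have [g <-] := trZ z0 z.
  rewrite -(card_preimset _ (can_inj (actK aX g))); apply: eq_card => x.
  by rewrite !inE fE (inj_eq (can_inj (actK aZ g))).
rewrite -sum1_card (partition_big f (mem P)) => [|x]; last by rewrite inE.
rewrite -sum_nat_const; apply: eq_bigr => z zP.
rewrite -(fibre z) -sum1_card; apply: eq_bigl => x; rewrite !inE.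
by case: eqVneq => [->|_]; rewrite ?andbF // andbT.
Qed.

Section CheegerBound.
Variables (R : realType) (G : groupType) (S : seq G).
Variables (Z : finType) (a : group_action G Z).

(** This is the orbit map of [z0], computed on chosen representatives [r]; two representatives of
    one coset differ by an element of the kernel, which fixes [z0]. *)
Lemma orbit_map (z0 : Z) : exists f : quotient_type (kernel a) -> Z,
  forall g C, f (translation (kernel a) g C) = a g (f C).
Proof.
have [r rE] := choice (@quotient_class_surj G (kernel a)).
exists (fun C => a (r C) z0) => g C; rewrite -actM.
have : kernel a ((g * r C)^-1 * r (translation (kernel a) g C)).
  apply: quotient_class_eq; rewrite -rE [in RHS](rE C) translation_class //.
by move=> /(_ z0)/(congr1 (a (g * r C))); rewrite -actM mulVKg.
Qed.

(** Pulling [P] back along the orbit map multiplies its size, that of [Z] and all flip counts by the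
    same [k], so the half-size condition and the ratio persist. *)
Lemma cheeger_kernel_le (P : {set Z}) : transitive_action a ->
  P != finset.set0 -> #|P|.*2 <= #|Z| ->
  (cheeger R (schreier_graph S (translation (kernel a))) <=
    ((\sum_(s <- S) #|flip P (a s)|)%N%:R / #|P|%:R)%R%:E)%E.
Proof.
move=> tra P0 P2; have [z0 z0P] := set0Pn _ P0.
have [f fE] := orbit_map z0.
have [k Hk] := equivariant_card_preimset fE tra.
have k0 : 0 < k.
  have : 0 < #|quotient_type (kernel a)|.
    by apply/card_gt0P; exists (quotient_class (kernel a) 1).
  rewrite -cardsT -(preimsetT f) Hk muln_gt0 => /andP[]//.
have P0' : 0 < #|P| by rewrite card_gt0.
pose W : {set schreier_graph S (translation (kernel a))} := f @^-1: P.
apply: (le_trans (y := (#|edge_boundary W|%:R / #|W|%:R)%:E%E)).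
  apply: bigmin_le_cond; apply/andP; split.
    by rewrite -card_gt0 Hk muln_gt0 P0'.
  rewrite -[leqRHS]cardsT -(preimsetT f) !Hk cardsT doubleMl.
  by rewrite leq_mul2r P2 orbT.
rewrite lee_fin Hk natrM invfM mulrA mulrAC ler_pM2r ?invr_gt0 ?ltr0n //.
rewrite ler_pdivrMr ?ltr0n // -natrM ler_nat.
apply: leq_trans (card_edge_boundary_schreier _ _ _) _.
rewrite big_distrl; apply: leq_sum => s _ /=; rewrite -Hk; apply/eq_leq/eq_card => x.
by rewrite !inE fE.
Qed.

End CheegerBound.

(** * The cyclic cover with [m.+1.*2] levels *)

Section CyclicCover.
Variables (X Y : finType) (x0 : X) (y0 : Y) (m : nat).

Let Z := ((X * Y) * 'I_m.+1.*2)%type.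

(* Conjugating only one of the two factors by this permutation lets the group
   change level, but merely over the base point. *)
Definition level_shift (z : Z) : Z :=
  if z.1 == (x0, y0) then (z.1, ordS z.2) else z.

Lemma level_shift_inj : injective level_shift.
Proof.
move=> [u i] [v j]; rewrite /level_shift /=.
case: eqVneq => [->|nu]; case: eqVneq => [->|nv] // E.
- by have /= /ordS_inj-> := congr1 snd E.
- by have /= vE := congr1 fst E; rewrite vE eqxx in nv.
- by have /= uE := congr1 fst E; rewrite uE eqxx in nu.
Qed.

Definition low_levels : {set Z} := [set z : Z | z.2 <= m].

Lemma card_low_levels : #|low_levels| = (#|X| * #|Y| * m.+1)%N.
Proof.
have mm : m.+1 <= m.+1.*2 by rewrite -addnn leq_addr.
have -> : low_levels = finset.setX [set: X * Y] [set i : 'I_m.+1.*2 | i <= m].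
  by apply/setP => z; rewrite !inE.
rewrite cardsX cardsT card_prod; congr (_ * _)%N.
have injw : injective (widen_ord mm) by move=> i j /(congr1 val) /= /val_inj.
rewrite -[RHS]card_ord -cardsT -(card_imset _ injw).
apply: eq_card => i; rewrite !inE; apply/idP/imsetP => [im|[j _ ->]].
  by exists (Ordinal (im : i < m.+1)) => //; apply: val_inj.
by rewrite /= -ltnS.
Qed.

(** Levels change only over the base point, and only the passages from level [m] to [m.+1] and from
    the top level [m.*2.+1] back to 0 cross between the halves. *)
Lemma card_flip_level_shift : #|flip low_levels level_shift| <= 2.
Proof.
have m1 : m < m.+1.*2 by rewrite -addnn ltn_addr.
have m2 : m.*2.+1 < m.+1.*2 by rewrite doubleS.
pose T : {set Z} := [set ((x0, y0), Ordinal m1); ((x0, y0), Ordinal m2)].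
have T2 : #|T| <= 2 by rewrite cards2; case: (_ != _).
apply: leq_trans T2; apply: subset_leq_card; apply/fintype.subsetP => -[u i].
rewrite !inE /level_shift /=; case: eqVneq => [->|_]; last by rewrite addbb.
rewrite !xpair_eqE !eqxx /= -!val_eqE /=.
have : i < m.*2.+2 by rewrite -doubleS.
rewrite ltnS leq_eqVlt => /predU1P[->|im]; first by rewrite eqxx orbT.
rewrite modn_small ?doubleS //; by case: (ltngtP i m).
Qed.

Variables (A B G : groupType).
Variables (iA : {multiplicative A -> G}) (iB : {multiplicative B -> G}).
Variables (aX : group_action A X) (aY : group_action B Y) (a : group_action G Z).

Let bX : group_action A Z :=
  prod_action (prod_action aX (trivial_action A Y)) (trivial_action A _).
Let bY : group_action B Z :=
  conj_action (prod_action (prod_action (trivial_action B X) aY) (trivial_action B _))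
    (perm level_shift_inj).

Hypotheses (aA : forall x z, a (iA x) z = bX x z).
Hypotheses (aB : forall y z, a (iB y) z = bY y z).

Lemma flip_left x : #|flip low_levels (a (iA x))| = 0.
Proof.
by apply: eq_card0 => z; rewrite !inE aA /= /prod_act /= addbb.
Qed.

(** The action of [y] is [p \o f \o p^-1] with [f] preserving levels; [p] and its inverse flip at
    most two points each. *)
Lemma flip_right y : #|flip low_levels (a (iB y))| <= 4.
Proof.
pose p : {perm Z} := perm level_shift_inj.
pose f : Z -> Z := prod_action (prod_action (trivial_action B X) aY) (trivial_action B _) y.
have pE : #|flip low_levels p| <= 2.
  rewrite (_ : flip _ _ = flip low_levels level_shift) ?card_flip_level_shift //.
  by apply/setP => z; rewrite !inE permE.
have f0 : #|flip low_levels f| = 0.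
  by apply: eq_card0 => z; rewrite !inE /= /prod_act /= addbb.
have -> : #|flip low_levels (a (iB y))| = #|flip low_levels (p \o (f \o (p^-1)%g))|.
  by apply: eq_card => z; rewrite !inE aB.
have injf : injective f by exact: can_inj (actK _ y).
apply: leq_trans (card_flip_comp _ _ _) _; first exact: inj_comp perm_inj.
rewrite -[4]/(2 + 2)%N leq_add //.
apply: leq_trans (card_flip_comp _ _ perm_inj) _.
by rewrite f0 add0n (card_flip_can _ (permK p) (permKV p)).
Qed.

Hypotheses (trX : transitive_action aX) (trY : transitive_action aY).
Hypotheses (X1 : exists x1, x1 != x0) (Y1 : exists y1, y1 != y0).

Lemma cyclic_cover_transitive : transitive_action a.
Proof.
pose conn z w := exists g, a g z = w.
have connT z w t : conn z w -> conn w t -> conn z t.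
  by move=> [g <-] [h <-]; exists (h * g); rewrite actM.
have connV z w : conn z w -> conn w z by move=> [g <-]; exists g^-1; rewrite actK.
have connX x x' y i : conn (x, y, i) (x', y, i).
  by have [g <-] := trX x x'; exists (iA g); rewrite aA.
have connY x y y' i : conn (level_shift (x, y, i)) (level_shift (x, y', i)).
  have [g <-] := trY y y'; exists (iB g).
  by rewrite aB /= /conj_act -[level_shift (x, y, i)](permE level_shift_inj)
    permK permE.
have [x1 x10] := X1; have [y1 y10] := Y1.
(* Over [x1], away from the base point, the shift is trivial: go there by [A], change [y] by [B],
   and return by [A]. *)
have level x y x' y' i : conn (x, y, i) (x', y', i).
  apply: (connT _ _ _ (connX _ x1 _ _)); apply: (connT _ _ _ _ (connX x1 _ _ _)).
  by have := connY x1 y y' i; rewrite /level_shift /= !xpair_eqE !(negPf x10).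
(* The shift raises [(x0, y0, i)] but not [(x0, y1, i)], so the conjugated [B]-orbit through them
   links two consecutive levels. *)
have next i : conn (x0, y0, ordS i) (x0, y0, i).
  apply: (connT _ _ _ _ (level x0 y1 _ _ _)).
  have := connY x0 y0 y1 i.
  by rewrite /level_shift /= !xpair_eqE !eqxx (negPf y10) /=.
have down n (i : 'I_m.+1.*2) : i = n :> nat -> conn (x0, y0, i) (x0, y0, ord0).
  elim: n i => [|n IHn] i ni.
    by have -> : i = ord0 by [apply: val_inj]; exists 1; rewrite act1.
  have nm : n < m.+1.*2 by rewrite (leq_ltn_trans (leqnSn n)) // -ni.
  apply: (connT _ _ _ _ (IHn (Ordinal nm) erefl)).
  have -> : i = ordS (Ordinal nm) by apply: val_inj; rewrite /= modn_small -?ni.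
  exact: next.
have base x y i : conn (x, y, i) (x0, y0, ord0).
  by exact: (connT _ _ _ (level _ _ x0 y0 _) (down i i erefl)).
by move=> [[x y] i] [[x' y'] i'];
  exact: (connT _ _ _ (base _ _ _) (connV _ _ (base _ _ _))).
Qed.

End CyclicCover.

(** * Flip bounds uniform in the number of levels, and the conclusion *)

Section FreeProductActions.
Variables (A B G : groupType).
Variables (iA : {multiplicative A -> G}) (iB : {multiplicative B -> G}).
Hypothesis freeG : is_free_product iA iB.
Hypotheses (rfA : residually_finite A) (rfB : residually_finite B).
Hypotheses (ntA : nontrivial A) (ntB : nontrivial B).

Definition slow_flips (Z : finType) (a : group_action G Z) (P : {set Z}) : Prop :=
  (forall x, #|flip P (a (iA x))| = 0) /\ (forall y, #|flip P (a (iB y))| <= 4).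

(** Elements with a uniform bound form a subgroup, by subadditivity and invariance under inversion,
    and it contains both factors. The order of quantifiers matters: [C] depends on [g] alone. *)
Lemma slow_flips_bounded g : exists C, forall (Z : finType) (a : group_action G Z) P,
  slow_flips a P -> #|flip P (a g)| <= C.
Proof.
pose H : set G := fun g => exists C, forall (Z : finType) (a : group_action G Z) P,
  slow_flips a P -> #|flip P (a g)| <= C.
apply: (free_product_generated freeG (H := H)).
- split.
  + exists 0 => Z a P _; rewrite leqn0; apply/eqP/eq_card0 => z.
    by rewrite !inE act1 addbb.
  + move=> g1 g2 [C1 H1] [C2 H2]; exists (C1 + C2)%N => Z a P sl.
    have -> : #|flip P (a (g1 * g2))| = #|flip P (a g1 \o a g2)|.
      by apply: eq_card => z; rewrite !inE actM.
    apply: leq_trans (card_flip_comp _ _ (can_inj (actK a g2))) _.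
    by rewrite leq_add ?H1 ?H2.
  + move=> g1 [C1 H1]; exists C1 => Z a P sl.
    by rewrite (card_flip_can _ (actK a g1) (actVK a g1)) H1.
- by move=> x; exists 0 => Z a P [-> _].
- by move=> y; exists 4 => Z a P [_].
Qed.

Lemma nontrivial_quotient (K : groupType) : residually_finite K -> nontrivial K ->
  exists (X : finType) (a : group_action K X) (x0 : X),
    transitive_action a /\ exists x1, x1 != x0.
Proof.
move=> rfK [g /rfK[N Ng]]; exists (quotient_type N), (translation N), (quotient_class N 1).
split; first exact: translation_transitive.
exists (translation N g (quotient_class N 1)).
by apply/eqP => /translation_fixes.
Qed.

Lemma slow_flips_exist (m : nat) :
  exists (Z : finType) (a : group_action G Z) (P : {set Z}),
    [/\ transitive_action a, m < #|P|, #|P|.*2 <= #|Z| & slow_flips a P].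
Proof.
have [X [aX [x0 [trX X1]]]] := nontrivial_quotient rfA ntA.
have [Y [aY [y0 [trY Y1]]]] := nontrivial_quotient rfB ntB.
have [a [aA aB]] := joint_action freeG
  (prod_action (prod_action aX (trivial_action A Y)) (trivial_action A 'I_m.+1.*2))
  (conj_action (prod_action (prod_action (trivial_action B X) aY)
    (trivial_action B 'I_m.+1.*2)) (perm (@level_shift_inj X Y x0 y0 m))).
exists _, a, (low_levels X Y m); split.
- exact: cyclic_cover_transitive aA aB trX trY X1 Y1.
- rewrite card_low_levels leq_pmull // muln_gt0.
  by apply/andP; split; apply/card_gt0P; [exists x0 | exists y0].
- by rewrite card_low_levels !card_prod card_ord doubleMr.
- by split=> [x|y]; [apply: flip_left aA x | apply: flip_right aB y].
Qed.

End FreeProductActions.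

Theorem proposition3 (R : realType) (A B G : groupType)
    (iA : {multiplicative A -> G}) (iB : {multiplicative B -> G})
    (fgA : finitely_generated A) (fgB : finitely_generated B)
    (rfA : residually_finite A) (rfB : residually_finite B)
    (ntA : nontrivial A) (ntB : nontrivial B)
    (freeG : is_free_product iA iB) :
  exists N : nat -> fin_index_normal G,
    (forall g : G, (forall n, N n g) -> g = 1) /\
    ~ expander_quotients R N.
Proof.
have fgG := free_product_finitely_generated freeG fgA fgB.
have rfG := free_product_residually_finite freeG rfA rfB.
have [N sepN] := separating_sequence fgG rfG.
have [K HK] : {K : nat -> fin_index_normal G & forall m,
    exists (Z : finType) (a : group_action G Z) (P : {set Z}), K m = kernel a /\
    [/\ transitive_action a, m < #|P|, #|P|.*2 <= #|Z| & slow_flips iA iB a P]}.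
  apply: (@choice _ _ (fun m (M : fin_index_normal G) =>
    exists (Z : finType) (a : group_action G Z) (P : {set Z}), M = kernel a /\
    [/\ transitive_action a, m < #|P|, #|P|.*2 <= #|Z| & slow_flips iA iB a P])) => m.
  have [Z [a [P HP]]] := slow_flips_exist freeG rfA rfB ntA ntB m.
  by exists (kernel a), Z, a, P.
(* Even indices give trivial intersection; odd ones defeat every constant [c]. *)
exists (fun n => if odd n then K n./2 else N n./2); split=> [g Hg|[S _ [c c0 Hc]]].
  by apply: sepN => n; have := Hg n.*2; rewrite odd_double doubleK.
have [C HC] := choice (slow_flips_bounded freeG).
pose D := (\sum_(s <- S) C s)%N.
(* With this [m], [D / c < m.+1 <= #|P|], so the Cheeger bound [D / #|P|] falls below [c]. *)
pose m := Num.truncn (D%:R / c)%R.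
have := Hc m.*2.+1; rewrite /= odd_double /= uphalf_double.
have [Z [a [P [-> [tra mP P2 sl]]]]] := HK m.
have P0 : P != finset.set0 by rewrite -card_gt0 (leq_ltn_trans _ mP).
move=> /le_trans/(_ (cheeger_kernel_le R S tra P0 P2)); rewrite lee_fin.
have P0' : (0 < #|P|%:R :> R)%R by rewrite ltr0n card_gt0.
rewrite ler_pdivlMr // leNgt => /negP[].
apply: (le_lt_trans (y := D%:R%R)).
  by rewrite ler_nat; apply: leq_sum => s _; apply: HC.
rewrite mulrC -ltr_pdivrMr //; apply: lt_le_trans (truncnS_gt _) _.
by rewrite ler_nat.
Qed.
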